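(* For every $\epsilon>0$ there is an explicit construction (a generalized Johnson graph) yielding, for infinitely many $n$, a graph $G$ on $n$ vertices such that (1) $\vartheta(G)/\alpha(G)=\Omega(n^{1-\epsilon})$; (2) $\vartheta(G)/c(G)=\Omega(n^{1-\epsilon})$; (3) $\chi(G)/\vartheta(G^c)=\Omega(n^{1-\epsilon})$, where the implied constants do not depend on $n$.
   Context: For a graph $G$ on $N$ vertices, the Lovász number is $\vartheta(G)=\max\sum_{i,j}b_{ij}$ over all $N\times N$ positive semidefinite matrices $B=(b_{ij})$ with trace $1$ and $b_{ij}=0$ whenever $ij$ is an edge. $\alpha(G)$ is the independence number, $\chi(G)$ the chromatic number, $G^c$ the complement of $G$. The Shannon capacity is $c(G)=\lim_{m\to\infty}\alpha(G^{\boxtimes m})^{1/m}$, where $\boxtimes$ is the strong product: $(u_1,v_1)\sim(u_2,v_2)$ in $G\boxtimes H$ iff ($u_1=u_2$ and $v_1\sim v_2$) or ($u_1\sim u_2$ and $v_1=v_2$) or ($u_1\sim u_2$ and $v_1\sim v_2$). A generalized Johnson graph $G(n,k,L)$, for $L\subset\{0,\ldots,k-1\}$, has vertex set the $k$-subsets of $\{1,\ldots,n\}$, with $A,B$ adjacent iff $|A\cap B|\notin L$. *)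

(* Defs.v *)
From HB Require Import structures.
From mathcomp Require Import all_boot all_order all_algebra.
From mathcomp Require Import all_classical all_reals all_analysis.
Set Implicit Arguments. Unset Strict Implicit. Unset Printing Implicit Defensive.
Import Order.TTheory GRing.Theory Num.Theory.
Local Open Scope ring_scope.

(* A (simple) graph on a finite vertex type T is a relation e : rel T;
   all graphs below are symmetric and irreflexive by construction. *)

Definition independent (T : finType) (e : rel T) (S : {set T}) : bool :=
  [forall x in S, forall y in S, ~~ e x y].

Definition alpha (T : finType) (e : rel T) : nat :=
  \max_(S : {set T} | independent e S) #|S|.

Definition compl_graph (T : finType) (e : rel T) : rel T :=
  fun x y : T => (x != y) && ~~ e x y.

(* Chromatic number: least k such that a proper k-colouring exists
   (k = #|T| always works for a loopless graph, so the default is never hit). *)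
Definition proper_colouring (T : finType) (e : rel T) (k : nat)
  (f : {ffun T -> 'I_k}) : bool :=
  [forall x, forall y, e x y ==> (f x != f y)].

Definition colourable (T : finType) (e : rel T) (k : nat) : bool :=
  [exists f : {ffun T -> 'I_k}, proper_colouring e f].

Definition chi (T : finType) (e : rel T) : nat :=
  \big[minn/#|T|]_(k < #|T|.+1 | colourable e k) k.

Definition strong_pow (T : finType) (e : rel T) (m : nat) : rel {ffun 'I_m -> T} :=
  fun u v : {ffun 'I_m -> T} =>
    (u != v) && [forall i : 'I_m, (u i == v i) || e (u i) (v i)].

Arguments strong_pow {T} e m.

Definition shannon_capacity (R : realType) (T : finType) (e : rel T) : R :=
  limn (fun m : nat => ((alpha (strong_pow e m))%:R : R) `^ (m%:R)^-1).

Definition psd (R : realType) (n : nat) (B : 'M[R]_n) : Prop :=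
  B^T = B /\ forall v : 'rV[R]_n, 0 <= (v *m B *m v^T) 0 0.

Definition theta_feasible (R : realType) (T : finType) (e : rel T)
  (B : 'M[R]_#|T|) : Prop :=
  psd B /\ \tr B = 1 /\
  forall i j : 'I_#|T|, e (enum_val i) (enum_val j) -> B i j = 0.

Definition theta (R : realType) (T : finType) (e : rel T) : R :=
  sup [set s : R | exists B : 'M[R]_#|T|,
         theta_feasible e B /\ s = \sum_i \sum_j B i j].

Definition johnson_vertex (m k : nat) : finType := {A : {set 'I_m} | #|A| == k}.

Definition johnson (m k : nat) (L : {set 'I_k}) : rel (johnson_vertex m k) :=
  fun A B : johnson_vertex m k =>
    (A != B) && [forall l in L, #|val A :&: val B| != val l].
Arguments johnson : clear implicits.

(* Main.v *)
(* Fix a prime p >= 2 / eps, put k = p^2 and let A, B be adjacent iff p divides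
   |A :&: B| (that is, L is the set of nonmultiples of p); the ground set size m
   tends to infinity, so the number n of vertices has order m^(p^2).

   Over 'F_p the matrix |A :&: B|^(p-1) - 1 vanishes at nonadjacent pairs and is
   nonzero on the diagonal, and its rank is at most m^(p-1) + 1; by Haemers'
   argument this bounds alpha(G) and the Shannon capacity, hence also
   chi(G) >= n / alpha(G).

   For theta one wants a function q with q(0) = q(p) = ... = q((p-1)p) = 0 and
   q(k) = O(m^p) such that the matrix q(|A :&: B|) dominates the all-ones matrix.
   Start with q = 1 and treat the zeros t in increasing order, replacing q(x) by
   q(x) - q(t) 'C(x, t) + |q(t)| (t+1) m 'C(x, t+1).  This keeps the earlier zeros,
   and the added term is positive semidefinite because the matrix 'C(|A :&: B|, t)
   is dominated by (t+1) m times the matrix 'C(|A :&: B|, t+1).  Such a q certifies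
   both theta(G) >= n / q(k) and theta(G^c) <= q(k).

   All three ratios are therefore at least of order n / m^(2p), and
   m^(2p) = O(n^(2/p)). *)
Require Import Defs.
From HB Require Import structures.
From mathcomp Require Import all_boot all_order all_algebra.
From mathcomp Require Import all_classical all_reals all_analysis.
From mathcomp Require Import ring lra zify.
From mathcomp Require Import finset.
Set Implicit Arguments. Unset Strict Implicit. Unset Printing Implicit Defensive.
Import Order.TTheory GRing.Theory Num.Theory numFieldNormedType.Exports.
Local Open Scope ring_scope.

(** * Inclusion forms *)

Definition bform (R : comNzRingType) (T : finType) (b : T -> T -> R)
  (u w : T -> R) : R := \sum_x \sum_y u x * b x y * w y.

Definition psd_kernel (R : numDomainType) (T : finType) (b : T -> T -> R) : Prop :=
  forall u, 0 <= bform b u u.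

Section Forms.
Context {R : realDomainType} {T : finType} (b : T -> T -> R).

Lemma eq_bform u u' w w' : u =1 u' -> w =1 w' -> bform b u w = bform b u' w'.
Proof.
move=> eu ew; apply: eq_bigr => x _; apply: eq_bigr => y _.
by rewrite eu ew.
Qed.

Lemma bform_suml (I : finType) (P : pred I) (u : I -> T -> R) w :
  bform b (fun x => \sum_(i | P i) u i x) w = \sum_(i | P i) bform b (u i) w.
Proof.
rewrite exchange_big; apply: eq_bigr => x _ /=.
rewrite exchange_big; apply: eq_bigr => y _ /=.
by rewrite !big_distrl.
Qed.

Lemma bform_sumr (I : finType) (P : pred I) (u : I -> T -> R) w :
  bform b w (fun x => \sum_(i | P i) u i x) = \sum_(i | P i) bform b w (u i).
Proof.
rewrite exchange_big; apply: eq_bigr => x _ /=.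
rewrite exchange_big; apply: eq_bigr => y _ /=.
by rewrite big_distrr.
Qed.

Lemma bform_sub u w : bform b (fun x => u x - w x) (fun x => u x - w x) =
  bform b u u - bform b u w - bform b w u + bform b w w.
Proof.
rewrite /bform -!sumrB -big_split /=; apply: eq_bigr => x _.
rewrite -!sumrB -big_split /=; apply: eq_bigr => y _; ring.
Qed.

Lemma bform_scale c u :
  bform b (fun x => c * u x) (fun x => c * u x) = c ^+ 2 * bform b u u.
Proof.
rewrite /bform mulr_sumr; apply: eq_bigr => x _.
rewrite mulr_sumr; apply: eq_bigr => y _; ring.
Qed.

(* The defect is half the sum over i, j of the form at u i - u j. *)
Lemma bform_sum_le (I : finType) (P : pred I) (u : I -> T -> R) :
  psd_kernel b ->
  bform b (fun x => \sum_(i | P i) u i x) (fun x => \sum_(i | P i) u i x)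
    <= #|P|%:R * \sum_(i | P i) bform b (u i) (u i).
Proof.
move=> b_psd; set S := \sum_(i | P i) bform b (u i) (u i).
have: 0 <= \sum_(i | P i) \sum_(j | P j)
    bform b (fun x => u i x - u j x) (fun x => u i x - u j x).
  by apply: sumr_ge0 => i _; apply: sumr_ge0.
under eq_bigr => i _ do
  (under eq_bigr => j _ do rewrite bform_sub;
   rewrite big_split 2!sumrB /= sumr_const -bform_sumr -bform_suml -/S).
rewrite big_split 2!sumrB /= sumr_const -bform_sumr -bform_suml -sumrMnl -/S.
set Q := bform b _ _; move=> h.
have e1 : \sum_(i | P i) (bform b (u i) (u i) *+ #|P|) = #|P|%:R * S by rewrite sumrMnl mulr_natl.
have e2 : (\sum_(i | P i) bform b (u i) (u i)) *+ #|P| = #|P|%:R * S by rewrite mulr_natl.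
rewrite ?e1 ?e2 in h; lra.
Qed.

End Forms.

Section InclusionForms.
Context {R : realDomainType} {T I : finType} (f : T -> {set I}) (k : nat).
Hypothesis card_f : forall x, #|f x| = k.

Definition inclusion_sum (b : T -> T -> R) (t : nat) : R :=
  \sum_x \sum_y 'C(#|f x :&: f y|, t)%:R * b x y.

Definition contains (S : {set I}) (x : T) : R := (S \subset f x)%:R.

(** The binomial counts the [t]-sets lying in both [f x] and [f y], so its matrix is a sum of
    rank-one matrices. Hence [inclusion_sum b t] is nonnegative for positive semidefinite [b]. *)
Lemma inclusion_sumE b t :
  inclusion_sum b t = \sum_(S : {set I} | #|S| == t) bform b (contains S) (contains S).
Proof.
rewrite /bform exchange_big; apply: eq_bigr => x _ /=.
rewrite exchange_big; apply: eq_bigr => y _ /=.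
have -> : 'C(#|f x :&: f y|, t)%:R =
    \sum_(S : {set I} | #|S| == t) (contains S x * contains S y) :> R.
  rewrite -cards_draws -sum1_card natr_sum.
  rewrite (eq_bigl (fun S : {set I} => (#|S| == t) && (S \subset f x :&: f y))); last first.
    by move=> S; rewrite inE andbC.
  rewrite big_mkcondr /=; apply: eq_bigr => S _.
  rewrite /contains subsetI -natrM mulnb.
  by case: ifP.
rewrite mulr_suml; apply: eq_bigr => S _; ring.
Qed.

(** If [S] lies in [f x], exactly the [k - t] elements of [f x] outside [S] contribute; otherwise
    both sides vanish. *)
Lemma sum_contains_insert t (S : {set I}) x : #|S| = t ->
  \sum_(a | a \notin S) contains (a |: S) x = (k - t)%:R * contains S x.
Proof.
move=> cS; rewrite /contains; case: (boolP (S \subset f x)) => [Sx|nSx]; last first.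
  rewrite mulr0 big1 // => a _.
  rewrite subUset (negbTE nSx) andbF //.
rewrite mulr1 -natr_sum -cS -(card_f x) -(cardsDS Sx) -sum1_card.
rewrite big_mkcond [in RHS]big_mkcond /=; congr _%:R.
apply: eq_bigr => a _; rewrite inE subUset Sx andbT sub1set.
by case: (a \in S); case: (a \in f x).
Qed.

(** Double counting: a set of size [t.+1] arises once for each of its elements [a], by removing
    [a]. *)
Lemma sum_insert (F : {set I} -> R) t :
  \sum_(S : {set I} | #|S| == t) \sum_(a | a \notin S) F (a |: S) =
  t.+1%:R * \sum_(S : {set I} | #|S| == t.+1) F S.
Proof.
rewrite (exchange_big_dep predT) //=.
transitivity (\sum_a \sum_(S : {set I} | (#|S| == t.+1) && (a \in S)) F S).
  apply: eq_bigr => a _.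
  rewrite [RHS](reindex_onto (fun S => a |: S) (fun S => S :\ a)) /=; last first.
    by move=> S /andP[_ aS]; rewrite setD1K.
  apply: eq_bigl => S; rewrite setU11 andbT.
  case: (boolP (a \in S)) => aS; rewrite ?andbF ?andbT.
    suff -> : (((a |: S) :\ a) == S) = false by rewrite andbF.
    by apply/eqP => e; move: aS; rewrite -e !inE eqxx.
  by rewrite cardsU1 aS setU1K // eqxx andbT.
rewrite (exchange_big_dep (fun S : {set I} => #|S| == t.+1)) //=; last first.
  by move=> a S _ /andP[].
rewrite mulr_sumr; apply: eq_bigr => S cS.
by rewrite (eq_bigl (mem S)) => [|a]; rewrite ?cS // sumr_const (eqP cS) mulr_natl.
Qed.

(* Cauchy-Schwarz applied to sum_contains_insert, summed over all t-sets S. *)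
Lemma inclusion_sum_le b t : psd_kernel b -> (t < k)%N ->
  inclusion_sum b t <= (t.+1 * #|I|)%:R * inclusion_sum b t.+1.
Proof.
move=> b_psd ltk; rewrite !inclusion_sumE natrM mulrAC -sum_insert mulr_suml.
apply: ler_sum => S /eqP cS; rewrite mulrC.
set V := bform b _ _; have V0 : 0 <= V by exact: b_psd.
have := bform_sum_le (fun a => a \notin S) (fun a => contains (a |: S)) b_psd.
have eV x := sum_contains_insert x cS.
rewrite (eq_bform _ eV eV) bform_scale -/V.
set W := \sum_(a | _) _ => h.
have W0 : 0 <= W by apply: sumr_ge0.
(* [t < k] makes the square at least 1, and at most [#|I|] elements lie outside [S]. *)
apply: le_trans (_ : (k - t)%:R ^+ 2 * V <= _).
  by rewrite ler_peMl // -natrX ler1n expn_gt0 subn_gt0 ltk.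
apply: le_trans h _; rewrite ler_wpM2r // ler_nat max_card //.
Qed.

Lemma exists_vanishing_kernel (t : nat -> nat) (s : nat) :
  (0 < #|I|)%N -> {homo t : i j / (i < j)%N} ->
  (forall i, (i < s)%N -> (t i < k)%N) ->
  exists q : nat -> R,
    [/\ forall i, (i < s)%N -> q (t i) = 0,
        forall x, (x <= k)%N -> `|q x| <= ((k.+2 * 2 ^ k)%:R * #|I|%:R) ^+ s
      & forall b, psd_kernel b ->
         \sum_x \sum_y b x y <= \sum_x \sum_y q #|f x :&: f y| * b x y].
Proof.
move=> I0 tmono; elim: s => [|s IH] tk.
  exists (fun=> 1); split=> // [x _|b _]; first by rewrite normr1.
  by apply: ler_sum => x _; apply: ler_sum => y _; rewrite mul1r.
have [i si|q [q0 qb qf]] := IH; first by apply: tk; rewrite ltnW.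
pose u := t s.
exists (fun x => q x - q u * 'C(x, u)%:R
               + `|q u| * (u.+1 * #|I|)%:R * 'C(x, u.+1)%:R); split.
(* Both binomials vanish below [u], which keeps the earlier zeros; at [u] they are 1 and 0, so [q u]
   cancels. *)
- move=> i; rewrite ltnS leq_eqVlt => /orP[/eqP->|lis].
    by rewrite -/u binn bin_small // mulr0 addr0 mulr1 subrr.
  have iu : (t i < u)%N by exact: tmono.
  by rewrite !bin_small // ?ltnS 1?ltnW // !mulr0 subr0 addr0 q0.
- move=> x xk; have uk : (u < k)%N by apply: tk.
  have bC j : 'C(x, j)%:R <= (2 ^ k)%:R :> R.
    rewrite ler_nat (leq_trans _ (leq_pexp2l _ xk)) //.
    rewrite -[x]card_ord -cardsT -card_powerset -cards_draws.
    rewrite subset_leq_card //; apply/fintype.subsetP => A.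
    by rewrite !inE => /andP[].
  rewrite exprSr; set E := _ ^+ s.
  have qu := qb u (ltnW uk); have qx := qb x xk.
  rewrite -/E in qu qx.
  have I1 : 1 <= #|I|%:R :> R by rewrite ler1n.
  have E0 : 0 <= E by exact: le_trans qx.
  have P1 : 1 <= (2 ^ k)%:R :> R by rewrite ler1n expn_gt0.
  (* Since [u.+1 <= k], one more zero costs a factor of at most [1 + 2 ^ k + k * #|I| * 2 ^ k],
     which is below [(k + 2) * 2 ^ k * #|I|]. *)
  apply: le_trans (_ : E + E * (2 ^ k)%:R + E * (k%:R * #|I|%:R) * (2 ^ k)%:R <= _).
    apply: le_trans (ler_normD _ _) _; apply: lerD.
      apply: le_trans (ler_normB _ _) _; apply: lerD => //.
      rewrite normrM; apply: ler_pM => //; by rewrite normr_nat.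
    rewrite !normrM normr_id !normr_nat natrM; apply: ler_pM => //.
      apply: ler_pM => //; apply: ler_wpM2r => //; by rewrite ler_nat.
  rewrite -!mulrA -{1}[E]mulr1 -!mulrDr ler_wpM2l // natrM.
  rewrite -[k.+2]addn2 natrD.
  set Y := (2 ^ k)%:R in P1 *; set m := #|I|%:R in I1 *.
  have Ym : 1 <= Y * m by rewrite -[1]mulr1 ler_pM.
  have Ym' : Y <= Y * m by rewrite ler_peMr // (le_trans _ P1).
  by nra.
- move=> b bp; apply: le_trans (qf b bp) _.
  have h := inclusion_sum_le bp (tk s (ltnSn s)).
  have h0 : 0 <= inclusion_sum b u.
    by rewrite inclusion_sumE; apply: sumr_ge0 => S _; apply: bp.
  have -> : \sum_x \sum_y (q #|f x :&: f y| - q u * 'C(#|f x :&: f y|, u)%:R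
      + `|q u| * (u.+1 * #|I|)%:R * 'C(#|f x :&: f y|, u.+1)%:R) * b x y =
    \sum_x \sum_y q #|f x :&: f y| * b x y - q u * inclusion_sum b u
      + `|q u| * ((u.+1 * #|I|)%:R * inclusion_sum b u.+1).
    rewrite /inclusion_sum mulrA !mulr_sumr -sumrB -big_split /=.
    apply: eq_bigr => x _; rewrite !mulr_sumr -sumrB -big_split /=.
    by apply: eq_bigr => y _; ring.
  (* The subtracted term is at most [|q u| * inclusion_sum b u], and by [h] the added term
     compensates for it. *)
  have := ler_wpM2l (normr_ge0 (q u)) h.
  have := ler_wpM2r h0 (ler_norm (q u)).
  lra.
Qed.

End InclusionForms.

(** * Independence number, Shannon capacity and chromatic number *)

(* A matrix of rank at most #|J| that fits the graph in the sense of Haemers: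
   no condition is imposed on the entries at adjacent pairs. *)
Definition rank_rep (F : fieldType) (T J : finType) (e : rel T) (u w : T -> J -> F) :=
  (forall x, \sum_j u x j * w x j != 0) /\
  (forall x y, x != y -> ~~ e x y -> \sum_j u x j * w y j = 0).

Lemma independentP (T : finType) (e : rel T) (S : {set T}) :
  reflect {in S &, forall x y, ~~ e x y} (independent e S).
Proof.
apply: (iffP forall_inP) => [h x y xS yS|h x xS].
  by have /forall_inP := h x xS; apply.
by apply/forall_inP => y yS; apply: h.
Qed.

(** On an independent set the matrix is diagonal with nonzero entries; scaling its rows gives an
    identity matrix that factors through dimension [#|J|]. *)
Lemma alpha_rank_rep (F : fieldType) (T J : finType) (e : rel T) (u w : T -> J -> F) :
  rank_rep e u w -> (alpha e <= #|J|)%N.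
Proof.
move=> [uw1 uw0]; apply/bigmax_leqP => S /independentP indS.
pose s (i : 'I_#|S|) : T := enum_val i.
pose d x := \sum_j u x j * w x j.
pose A : 'M[F]_(#|S|, #|J|) := \matrix_(i, j) ((d (s i))^-1 * u (s i) (enum_val j)).
pose B : 'M[F]_(#|J|, #|S|) := \matrix_(j, i) w (s i) (enum_val j).
apply: (@mulmx1_min _ _ _ A B); apply/matrixP => i i'; rewrite !mxE.
under eq_bigr => j _ do rewrite !mxE -mulrA.
rewrite -mulr_sumr.
have -> : \sum_(j < #|J|) u (s i) (enum_val j) * w (s i') (enum_val j) =
  \sum_j u (s i) j * w (s i') j.
  by rewrite [RHS]big_enum_val.
have [<-|ne] := eqVneq i i'; first by rewrite mulVf //; apply: uw1.
rewrite uw0 ?mulr0 //; last by apply: indS; apply: enum_valP.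
by apply: contra ne => /eqP /enum_val_inj ->.
Qed.

(** This is the tensor power: entries multiply over coordinates, and distinct nonadjacent tuples
    have a coordinate where they are distinct and nonadjacent, which contributes a factor 0. *)
Lemma rank_rep_strong_pow (F : fieldType) (T J : finType) (e : rel T)
    (u w : T -> J -> F) (m : nat) : rank_rep e u w ->
  rank_rep (strong_pow e m)
    (fun (x : {ffun 'I_m -> T}) (j : {ffun 'I_m -> J}) => \prod_i u (x i) (j i))
    (fun (x : {ffun 'I_m -> T}) (j : {ffun 'I_m -> J}) => \prod_i w (x i) (j i)).
Proof.
move=> [uw1 uw0].
have prodE (x y : {ffun 'I_m -> T}) :
    \sum_(j : {ffun 'I_m -> J}) (\prod_i u (x i) (j i)) * (\prod_i w (y i) (j i)) =
    \prod_i \sum_j u (x i) j * w (y i) j.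
  rewrite (bigA_distr_bigA (fun i j => u (x i) j * w (y i) j)).
  by apply: eq_bigr => f _; rewrite big_split.
split=> [x|x y xy]; first by rewrite prodE; apply/prodf_neq0 => i _; apply: uw1.
rewrite /strong_pow xy /= => /forallPn[i]; rewrite negb_or => /andP[nxy nexy].
by rewrite prodE (bigD1 i) //= uw0 // mul0r.
Qed.

Lemma alpha_strong_pow_le (F : fieldType) (T J : finType) (e : rel T)
    (u w : T -> J -> F) (m : nat) : rank_rep e u w ->
  (alpha (strong_pow e m) <= #|J| ^ m)%N.
Proof.
move=> /rank_rep_strong_pow -/(_ m) /alpha_rank_rep.
by rewrite card_ffun card_ord.
Qed.

Lemma alpha_max (T : finType) (e : rel T) :
  exists2 S : {set T}, independent e S & alpha e = #|S|.
Proof.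
have i0 : independent e (set0 : {set T}) by apply/independentP => x y; rewrite inE.
have iA : (0 < #|[pred S | independent e S]|)%N by apply/card_gt0P; exists set0.
by have [S indS eqS] := eq_bigmax_cond (fun S : {set T} => #|S|) iA; exists S.
Qed.

Lemma alpha_ge (T : finType) (e : rel T) (S : {set T}) :
  independent e S -> (#|S| <= alpha e)%N.
Proof. by move=> indS; exact: (bigop.leq_bigmax_cond S indS). Qed.

Lemma alpha_gt0 (T : finType) (e : rel T) : irreflexive e -> (0 < #|T|)%N ->
  (0 < alpha e)%N.
Proof.
move=> eirr /card_gt0P[x _]; rewrite -(cards1 x); apply: alpha_ge.
by apply/independentP => y z; rewrite !inE => /eqP-> /eqP->; rewrite eirr.
Qed.

Lemma strong_pow_irr (T : finType) (e : rel T) m : irreflexive (strong_pow e m).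
Proof. by move=> x; rewrite /strong_pow eqxx. Qed.

(** Concatenation embeds the product of two independent sets as an independent set: adjacent
    concatenations would have adjacent first halves, or equal first halves and adjacent second
    halves. *)
Lemma alpha_strong_powD (T : finType) (e : rel T) a b :
  (alpha (strong_pow e a) * alpha (strong_pow e b) <=
   alpha (strong_pow e (a + b)))%N.
Proof.
have [A /independentP iA ->] := alpha_max (strong_pow e a).
have [B /independentP iB ->] := alpha_max (strong_pow e b).
pose cat (z : {ffun 'I_a -> T} * {ffun 'I_b -> T}) : {ffun 'I_(a + b) -> T} :=
  [ffun i : 'I_(a + b) => match fintype.split i with inl j => z.1 j | inr j => z.2 j end].
have catl z j : cat z (lshift b j) = z.1 j.
  by rewrite ffunE (unsplitK (inl j : 'I_a + 'I_b)).
have catr z j : cat z (rshift a j) = z.2 j.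
  by rewrite ffunE (unsplitK (inr j : 'I_a + 'I_b)).
have cat_inj : injective cat.
  move=> [x y] [x' y'] /ffunP h; congr pair; apply/ffunP => j.
    by have := h (lshift b j); rewrite !catl.
  by have := h (rshift a j); rewrite !catr.
rewrite -cardsX -(card_imset _ cat_inj); apply: alpha_ge.
apply/independentP => _ _ /imsetP[[x y] + ->] /imsetP[[x' y'] + ->].
rewrite !inE /= => /andP[xA yB] /andP[x'A y'B].
apply/negP => /andP[ne /forallP h].
have [xx|xx] := eqVneq x x'.
  have yy : y != y' by apply: contra ne => /eqP ->; rewrite xx.
  move/negP: (iB _ _ yB y'B); apply; rewrite /strong_pow yy; apply/forallP => j.
  by have := h (rshift a j); rewrite !catr.
move/negP: (iA _ _ xA x'A); apply; rewrite /strong_pow xx; apply/forallP => j.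
by have := h (lshift b j); rewrite !catl.
Qed.

Lemma card_le_chi_alpha (T : finType) (e : rel T) : irreflexive e ->
  (#|T| <= chi e * alpha e)%N.
Proof.
move=> eirr; have [->|] := posnP #|T|; first by [].
move=> T0; rewrite /chi.
pose Q k := (#|T| <= k * alpha e)%N.
(* [chi] is an iterated minimum, so the bound is checked on the default [#|T|], on minima, and on
   each colourable [k], where the colour classes are independent. *)
apply: (big_ind Q) => [|x y|k /existsP[f /forallP pf]]; rewrite /Q.
- by rewrite leq_pmulr // alpha_gt0.
- by rewrite /minn; case: ifP.
suff: (\sum_(x : T) 1 <= \sum_(c < k) alpha e)%N.
  by rewrite sum1_card sum_nat_const card_ord.
rewrite (partition_big f predT) //=.
apply: leq_sum => c _; rewrite sum1dep_card; apply: alpha_ge.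
apply/independentP => x y; rewrite !inE => /eqP fx /eqP fy.
by apply/negP => exy; have /forallP/(_ y) := pf x; rewrite exy fx fy eqxx.
Qed.

(** The functions [g] index the expansion of [|f x :&: f y| ^ (p - 1)] into products of membership
    indicators, and the [unit] index supplies the [-1]. The diagonal value is [-1]. *)
Lemma rank_rep_mod_prime (p : nat) (T I : finType) (f : T -> {set I}) (e : rel T) :
  prime p -> (forall x, (p %| #|f x|)%N) ->
  (forall x y, x != y -> ~~ e x y -> ~~ (p %| #|f x :&: f y|)%N) ->
  exists u : T -> unit + {ffun 'I_p.-1 -> I} -> 'F_p,
  exists w : T -> unit + {ffun 'I_p.-1 -> I} -> 'F_p, rank_rep e u w.
Proof.
move=> pp f0 f1.
pose u x (j : unit + {ffun 'I_p.-1 -> I}) : 'F_p :=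
  if j is inr g then \prod_i (g i \in f x)%:R else -1.
pose w (x : T) (j : unit + {ffun 'I_p.-1 -> I}) : 'F_p :=
  if j is inr g then \prod_i (g i \in f x)%:R else 1.
exists u, w.
have uwE x y : \sum_j u x j * w y j = (#|f x :&: f y|)%:R ^+ p.-1 - 1.
  rewrite big_sumType /= big_const card_unit /= addr0 mulr1 addrC; congr (_ - _).
  under eq_bigr => g _ do rewrite -big_split /=.
  rewrite -(bigA_distr_bigA (fun i a => (a \in f x)%:R * (a \in f y)%:R)) /=.
  rewrite prodr_const card_ord; congr (_ ^+ _).
  rewrite -sum1_card natr_sum [RHS]big_mkcond /=; apply: eq_bigr => a _.
  by rewrite -natrM mulnb inE; case: andP.
split=> [x|x y xy exy]; rewrite uwE.
  rewrite setIid; have := dvdn_pcharf (pchar_Fp pp) #|f x|.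
  rewrite f0 => /esym/eqP ->; rewrite expr0n.
  have := prime_gt1 pp; case: p pp {f0 f1 u w uwE} => [|[|p]] //= pp _.
  by rewrite sub0r oppr_eq0 oner_eq0.
have := f1 x y xy exy; rewrite (dvdn_pcharf (pchar_Fp pp)) => c0.
(* Fermat's little theorem: after multiplication by the nonzero residue, the claim is that Frobenius
   fixes it. *)
apply/eqP; rewrite subr_eq0; apply/eqP; apply: (mulfI c0).
rewrite mulr1 -exprS prednK ?prime_gt0 //.
have := pFrobenius_aut_nat (pchar_Fp pp) #|f x :&: f y|.
by rewrite pFrobenius_autE.
Qed.

(** * Superadditive sequences and convergence to the Shannon capacity *)

Lemma superadditive_mul (R : realDomainType) (a : nat -> R) :
  (forall n, 0 <= a n) -> (forall m n, a m + a n <= a (m + n)%N) ->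
  forall q m r, q%:R * a m <= a (q * m + r)%N.
Proof.
move=> a0 aD q m r; elim: q => [|q IH]; first by rewrite mul0r.
rewrite mulSn -addnA -natr1 mulrDl mul1r addrC.
by apply: le_trans (aD _ _); rewrite lerD2l.
Qed.

(** The limit is the supremum of [a n / n] over positive [n], which the linear bound makes
    finite. *)
Lemma fekete (R : realType) (a : nat -> R) (c : R) :
  (forall n, 0 <= a n) -> (forall m n, a m + a n <= a (m + n)%N) ->
  (forall n, a n <= n%:R * c) ->
  cvgn (fun n => n%:R^-1 * a n).
Proof.
move=> a0 aD ac.
pose E : set R := fun x => exists n : nat, n.+1%:R^-1 * a n.+1 = x.
have E_sup : has_sup E.
  split; first by exists (1%:R^-1 * a 1); exists 0.
  exists c => _ [n <-].
  by rewrite ler_pdivrMl ?ltr0n //; exact: ac.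
suff : ((fun n => n%:R^-1 * a n) @ \oo --> sup E)%classic by move=> /cvgP.
apply/cvgrPdist_le => e e0.
(* [a M.+1 / M.+1] is within [e / 2] of the supremum. Dividing [n] by [M.+1] with remainder loses at
   most [a M.+1] from [a n], hence another [e / 2] for large [n]. *)
have [_ [M <-] hM] := sup_adherent (divr_gt0 e0 (ltr0Sn R 1)) E_sup.
near=> n.
have n0 : (0 < n)%N by near: n; exists 1.
have n0' : 0 < n%:R :> R by rewrite ltr0n.
have hle : n%:R^-1 * a n <= sup E.
  apply: ub_le_sup; first by case: E_sup.
  by exists n.-1; rewrite prednK.
rewrite ger0_norm ?subr_ge0 // lerBlDl -lerBlDr.
have M0 : 0 < M.+1%:R :> R by rewrite ltr0n.
have hn : a M.+1 <= n%:R * (e / 2).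
  rewrite -ler_pdivrMr ?divr_gt0 //; near: n.
  exists (Num.trunc (a M.+1 / (e / 2))).+1 => // j /= hj.
  by apply: ltW; apply: lt_le_trans (truncnS_gt _) _; rewrite ler_nat.
rewrite ler_pdivlMl //.
have h1 := superadditive_mul a0 aD (n %/ M.+1) M.+1 (n %% M.+1).
rewrite -divn_eq in h1.
apply: le_trans h1; set q := (n %/ _)%N.
have hq : n%:R - M.+1%:R <= q%:R * M.+1%:R :> R.
  rewrite lerBlDr -natrM -natrD ler_nat {1}(divn_eq n M.+1) leq_add2l.
  by rewrite ltnW // ltn_mod.
move: hM; rewrite -ltrBrDl; set x := _^-1 * _ => hM.
have ax : a M.+1 = M.+1%:R * x by rewrite /x mulVKf // gt_eqF.
have x0 : 0 <= x by rewrite mulr_ge0 // invr_ge0 ltW.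
have := ler_wpM2r x0 hq; rewrite mulrBl -mulrA -ax.
nra.
Unshelve. all: by end_near.
Qed.

Section Capacity.
Context (R : realType) (T : finType) (e : rel T) (D : nat).
Hypothesis T_gt0 : (0 < #|T|)%N.
Hypothesis alpha_le : forall m, (alpha (strong_pow e m) <= D ^ m)%N.

Let root (m : nat) : R := (alpha (strong_pow e m))%:R `^ (m%:R)^-1.

Let alpha1 m : (0 < alpha (strong_pow e m))%N.
Proof.
by apply: alpha_gt0; [exact: strong_pow_irr | rewrite card_ffun expn_gt0 T_gt0].
Qed.

Let alphaR1 m : 1 <= (alpha (strong_pow e m))%:R :> R.
Proof. by rewrite ler1n. Qed.

Let D_gt0 : (0 < D)%N.
Proof. by have := leq_trans (alpha1 1) (alpha_le 1); rewrite expn1. Qed.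

(** Convergence gives the [limn] in [shannon_capacity] its meaning. The logarithms of the
    independence numbers satisfy Fekete's lemma, and [expR] is continuous. *)
Lemma cvg_shannon_capacity : cvgn root.
Proof.
have -> : root = fun m => expR (m%:R^-1 * ln (alpha (strong_pow e m))%:R).
  apply/funext => m; rewrite /root /powR ifF //.
  by apply/negbTE; rewrite gt_eqF // (lt_le_trans ltr01).
have cv : cvgn (fun m => m%:R^-1 * ln (alpha (strong_pow e m))%:R : R).
  apply: (@fekete _ _ (ln D%:R)) => [m|a b|m].
  - exact: ln_ge0.
  - rewrite -lnM ?posrE ?ltr0n // -natrM ler_ln ?posrE ?ltr0n ?muln_gt0 ?alpha1 //.
    by rewrite ler_nat alpha_strong_powD.
  - rewrite mulr_natl -lnXn ?ltr0n // -natrX ler_ln ?posrE ?ltr0n ?expn_gt0 ?D_gt0 //.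
    by rewrite ler_nat.
apply/cvg_ex; exists (expR (limn (fun m => m%:R^-1 * ln (alpha (strong_pow e m))%:R))).
by apply: continuous_cvg => //; exact: continuous_expR.
Qed.

Lemma shannon_capacity_ge1 : 1 <= shannon_capacity R e.
Proof.
apply: limr_ge; first exact: cvg_shannon_capacity.
apply: nearW => m; have i0 : 0 <= m%:R^-1 :> R by rewrite invr_ge0.
by have := ler_powR (alphaR1 m) i0; rewrite powRr0.
Qed.

Lemma shannon_capacity_le : shannon_capacity R e <= D%:R.
Proof.
apply: limr_le; first exact: cvg_shannon_capacity.
(* At [m = 0] the exponent is the inverse of 0, which is 0, so the term is 1. *)
apply: nearW => m; have [->|m0] := posnP m.
  by rewrite invr0 powRr0 ler1n.
apply: le_trans (_ : (D%:R ^+ m) `^ m%:R^-1 <= _).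
  by apply: ge0_ler_powR; rewrite ?nnegrE ?invr_ge0 // -natrX ler_nat.
by rewrite -powR_mulrn // -powRrM mulfV ?pnatr_eq0 -?lt0n // powRr1.
Qed.

End Capacity.

(** * The Lovasz number *)

Section Theta.
Context (R : realType) (T : finType).
Implicit Types (e : rel T) (M b : T -> T -> R) (B : 'M[R]_#|T|).

Lemma sum_enum_val (F : T -> R) : \sum_x F x = \sum_(i < #|T|) F (enum_val i).
Proof. exact: big_enum_val. Qed.

Lemma psd_mx_kernel B : psd B ->
  psd_kernel (fun x y => B (enum_rank x) (enum_rank y)).
Proof.
move=> [_ Bge0] u; have := Bge0 (\row_i u (enum_val i)).
rewrite mxE /bform sum_enum_val exchange_big /= sum_enum_val.
congr (0 <= _); apply: eq_bigr => j _; rewrite !mxE mulr_suml.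
by apply: eq_bigr => i _; rewrite mxE !enum_valK.
Qed.

Lemma psd_kernel_mx M : (forall x y, M x y = M y x) -> psd_kernel M ->
  psd (\matrix_(i < #|T|, j < #|T|) M (enum_val i) (enum_val j)).
Proof.
move=> Msym Mge0; split; first by apply/matrixP => i j; rewrite !mxE.
move=> v; have := Mge0 (fun x => v 0 (enum_rank x)).
rewrite mxE /bform sum_enum_val exchange_big /= sum_enum_val.
congr (0 <= _); apply: eq_bigr => j _; rewrite !mxE mulr_suml.
by apply: eq_bigr => i _; rewrite mxE !enum_valK.
Qed.

Lemma psd_kernel_rank1 (u : T -> R) : psd_kernel (fun x y => u x * u y).
Proof.
move=> v; rewrite (_ : bform _ _ _ = (\sum_x v x * u x) ^+ 2) ?sqr_ge0 //.
rewrite expr2 mulr_suml; apply: eq_bigr => x _; rewrite mulr_sumr.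
by apply: eq_bigr => y _; ring.
Qed.

(* For symmetric M this says that M minus the all-ones matrix is positive
   semidefinite; it is kept in the dual form in which the theta bounds use it. *)
Definition dominates_ones M : Prop :=
  forall b, psd_kernel b -> \sum_x \sum_y b x y <= \sum_x \sum_y M x y * b x y.

(** Testing on the rank-one kernel of [u] bounds the form below by the square of the sum of [u]. *)
Lemma dominates_ones_psd M : dominates_ones M -> psd_kernel M.
Proof.
move=> domM u; apply: le_trans (_ : _ <= \sum_x \sum_y M x y * (u x * u y)) _.
  apply: le_trans (domM _ (psd_kernel_rank1 u)).
  rewrite (_ : \sum_x _ = (\sum_x u x) ^+ 2) ?sqr_ge0 //.
  by rewrite expr2 mulr_suml; apply: eq_bigr => x _; rewrite mulr_sumr.
apply: ler_sum => x _; apply: ler_sum => y _.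
by rewrite mulrCA mulrA.
Qed.

(** Obtained by writing the constant 1 as a sum of point indicators. It bounds every feasible sum by
    [#|T|], so that [theta] is the supremum of a bounded set. *)
Lemma dominates_ones_diag : dominates_ones (fun x y => #|T|%:R * (x == y)%:R).
Proof.
move=> b bp; have := bform_sum_le predT (fun i x => (x == i)%:R) bp.
have sum1 (x : T) : \sum_i (x == i)%:R = 1 :> R.
  by rewrite (bigD1 x) //= eqxx big1 ?addr0 // => i; rewrite eq_sym => /negbTE ->.
rewrite (eq_bform _ sum1 sum1) /bform mulr_sumr.
under eq_bigr => x _ do under eq_bigr => y _ do rewrite mul1r mulr1.
move=> /le_trans; apply; rewrite le_eqVlt; apply/orP; left; apply/eqP.
apply: eq_bigr => x _; rewrite (bigD1 x) //= [X in _ * (_ + X)]big1; last first.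
  by move=> y yx; apply: big1 => z _; rewrite (negbTE yx) !mul0r.
rewrite addr0 (bigD1 x) //= big1 => [|y yx]; last by rewrite (negbTE yx) mulr0.
rewrite eqxx addr0 mul1r mulr1 [RHS](bigD1 x) //= eqxx mulr1 big1 ?addr0 //.
by move=> y yx; rewrite eq_sym (negbTE yx) mulr0 mul0r.
Qed.

(** Weak duality: off the diagonal either [B] or [M] vanishes, so the dominating sum reduces to [c]
    times the trace of [B]. *)
Lemma theta_feasible_le e M c B : dominates_ones M -> (forall x, M x x = c) ->
  (forall x y, x != y -> ~~ e x y -> M x y = 0) ->
  theta_feasible e B -> \sum_i \sum_j B i j <= c.
Proof.
move=> domM Md M0 [Bp [Btr B0]].
pose b x y := B (enum_rank x) (enum_rank y).
have -> : \sum_i \sum_j B i j = \sum_x \sum_y b x y.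
  rewrite sum_enum_val; apply: eq_bigr => i _; rewrite sum_enum_val.
  by apply: eq_bigr => j _; rewrite /b !enum_valK.
apply: le_trans (domM b (psd_mx_kernel Bp)) _.
rewrite -[c]mulr1 -Btr /mxtrace mulr_sumr sum_enum_val le_eqVlt; apply/orP; left.
apply/eqP; apply: eq_bigr => i _; rewrite (bigD1 (enum_val i)) //= big1.
  by rewrite addr0 Md /b enum_valK.
move=> y yi; have [ei|nei] := boolP (e (enum_val i) y).
  by rewrite /b (B0 (enum_rank (enum_val i)) (enum_rank y)) ?mulr0 // !enum_rankK.
by rewrite M0 ?mul0r // eq_sym.
Qed.

(** A witness that the set defining [theta] is nonempty. *)
Lemma theta_feasible_scalar e : irreflexive e -> (0 < #|T|)%N ->
  theta_feasible e ((#|T|%:R^-1)%:M : 'M[R]_#|T|).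
Proof.
move=> eirr T0; split; [split|split].
- by rewrite tr_scalar_mx.
- move=> v; rewrite mul_mx_scalar -scalemxAl !mxE mulr_ge0 ?invr_ge0 //.
  by apply: sumr_ge0 => i _; rewrite !mxE -expr2 sqr_ge0.
- by rewrite mxtrace_scalar -(mulr_natr #|T|%:R^-1) mulVf // pnatr_eq0 -lt0n.
- move=> i j; rewrite mxE; have [->|] := eqVneq i j; last by rewrite mulr0n.
  by rewrite eirr.
Qed.

Lemma theta_upper e M c : irreflexive e -> (0 < #|T|)%N ->
  dominates_ones M -> (forall x, M x x = c) ->
  (forall x y, x != y -> ~~ e x y -> M x y = 0) -> theta R e <= c.
Proof.
move=> eirr T0 domM Md M0; apply: ge_sup.
  by eexists; eexists; split; [exact: theta_feasible_scalar|].
by move=> _ [B [Bf ->]]; exact: (theta_feasible_le domM Md M0 Bf).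
Qed.

Lemma theta_feasible_theta e B : theta_feasible e B ->
  \sum_i \sum_j B i j <= theta R e.
Proof.
move=> Bf; apply: ub_le_sup; last by exists B.
exists #|T|%:R => _ [B' [Bf' ->]].
apply: (theta_feasible_le dominates_ones_diag _ _ Bf') => [x|x y xy _].
  by rewrite eqxx mulr1.
by rewrite (negbTE xy) mulr0.
Qed.

Lemma theta_ge1 e : irreflexive e -> (0 < #|T|)%N -> 1 <= theta R e.
Proof.
move=> eirr T0; have Bf := theta_feasible_scalar eirr T0.
apply: le_trans (theta_feasible_theta Bf).
rewrite -{1}(Bf.2.1); apply: ler_sum => i _.
rewrite (bigD1 i) //= lerDl; apply: sumr_ge0 => j _.
by rewrite mxE mulrn_wge0 // invr_ge0.
Qed.

Lemma sum_delta2 (F : T -> T -> R) x0 :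
  \sum_x \sum_y F x y * ((x == x0)%:R * (y == x0)%:R) = F x0 x0.
Proof.
rewrite (bigD1 x0) //= [X in _ + X]big1 => [|x xx0]; last first.
  by apply: big1 => y _; rewrite (negbTE xx0) mul0r mulr0.
rewrite addr0 (bigD1 x0) //= big1 => [|y yx0]; last by rewrite (negbTE yx0) !mulr0.
by rewrite eqxx !mulr1 addr0.
Qed.

(** [M] divided by its trace [#|T| * c] is feasible. Testing domination on the constant kernel 1
    shows that the entries of [M] sum to at least [#|T| ^ 2]. *)
Lemma theta_lower e M c : irreflexive e -> (0 < #|T|)%N ->
  dominates_ones M -> (forall x y, M x y = M y x) -> (forall x, M x x = c) ->
  (forall x y, e x y -> M x y = 0) -> #|T|%:R <= c * theta R e.
Proof.
move=> eirr T0 domM Msym Md M0.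
have [x0 _] := card_gt0P T0.
have T0' : 0 < #|T|%:R :> R by rewrite ltr0n.
(* Domination is tested on the kernel concentrated at the single pair [(x0, x0)]. *)
have c1 : 1 <= c.
  have := domM _ (psd_kernel_rank1 (fun x => (x == x0)%:R)).
  rewrite sum_delta2 Md; apply: le_trans.
  rewrite -[leLHS](sum_delta2 (fun _ _ => 1) x0) le_eqVlt; apply/orP; left.
  by apply/eqP; apply: eq_bigr => x _; apply: eq_bigr => y _; rewrite mul1r.
have c0 : 0 < c by exact: lt_le_trans c1.
pose d := (#|T|%:R * c)^-1.
have d0 : 0 < d by rewrite invr_gt0 mulr_gt0.
pose M' x y := d * M x y.
have M'p : psd_kernel M'.
  move=> u; rewrite (_ : bform _ _ _ = d * bform M u u).
    by apply: mulr_ge0; [exact: ltW | exact: dominates_ones_psd].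
  rewrite /bform mulr_sumr; apply: eq_bigr => x _; rewrite mulr_sumr.
  by apply: eq_bigr => y _; rewrite /M'; ring.
pose B : 'M[R]_#|T| := \matrix_(i, j) M' (enum_val i) (enum_val j).
have Bf : theta_feasible e B.
  split; first by apply: psd_kernel_mx => // x y; rewrite /M' Msym.
  split; last by move=> i j /M0 h; rewrite mxE /M' h mulr0.
  rewrite /mxtrace; under eq_bigr => i _ do rewrite mxE /M' Md.
  by rewrite sumr_const card_ord -mulr_natl /d; field; rewrite !gt_eqF.
have := theta_feasible_theta Bf; rewrite -(ler_pM2l c0); apply: le_trans.
have -> : \sum_i \sum_j B i j = d * \sum_x \sum_y M x y.
  rewrite sum_enum_val mulr_sumr; apply: eq_bigr => i _.
  by rewrite sum_enum_val mulr_sumr; apply: eq_bigr => j _; rewrite mxE.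
have : #|T|%:R ^+ 2 <= \sum_x \sum_y M x y.
  have := domM _ (psd_kernel_rank1 (fun=> 1)).
  have -> : \sum_(x : T) \sum_(y : T) (1 * 1 : R) = #|T|%:R ^+ 2.
    have e1 : \sum_(y : T) (1 * 1) = #|T|%:R :> R by rewrite mulr1 sumr_const.
    by rewrite (eq_bigr (fun=> #|T|%:R)) // sumr_const expr2 mulr_natl.
  move=> /le_trans; apply; apply: ler_sum => x _; apply: ler_sum => y _.
  by rewrite !mulr1.
rewrite -(ler_pM2l (mulr_gt0 c0 d0)) [c * (d * _)]mulrA; apply: le_trans.
by rewrite (_ : _ * _ = #|T|%:R) // /d; field; rewrite !gt_eqF.
Qed.

End Theta.

(** * Johnson graphs *)

Lemma card_johnson_vertex m k : #|johnson_vertex m k| = 'C(m, k).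
Proof.
rewrite card_sig -[m in RHS]card_ord -card_draws cardE.
by rewrite cardE; congr size; apply: eq_enum => A; rewrite !inE.
Qed.

(** The falling factorial is compared factor by factor: [m <= 2 * (m - j)] for [j < k]. *)
Lemma expn_le_bin m k : (k.*2 <= m)%N -> (m ^ k <= 2 ^ k * k`! * 'C(m, k))%N.
Proof.
move=> km; rewrite -mulnA [(k`! * _)%N]mulnC bin_ffact.
have h j : (j <= k)%N -> (m ^ j <= 2 ^ j * m ^_ j)%N.
  elim: j => [|j IH] jk //; rewrite expnSr ffactnSr expnSr mulnACA.
  by apply: leq_mul; [apply: IH; exact: ltnW | lia].
exact: h.
Qed.

Lemma johnson_irr m k L : irreflexive (johnson m k L).
Proof. by move=> A; rewrite /johnson eqxx. Qed.

Lemma compl_graph_irr (T : finType) (e : rel T) : irreflexive (compl_graph e).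
Proof. by move=> x; rewrite /compl_graph eqxx. Qed.

Definition nonmultiples (p k : nat) : {set 'I_k} := [set l : 'I_k | ~~ (p %| l)%N].

Lemma card_johnson_setI m k (A B : johnson_vertex m k) : A != B ->
  (#|val A :&: val B| < k)%N.
Proof.
rewrite ltnNge; apply: contra => le.
have [/eqP cA /eqP cB] := (valP A, valP B).
have eA : val A :&: val B = val A by apply/eqP; rewrite eqEcard subsetIl cA.
have eB : val A :&: val B = val B by apply/eqP; rewrite eqEcard subsetIr cB.
by apply/eqP/val_inj; rewrite -eA eB.
Qed.

Lemma johnson_nonmultiples p m k (A B : johnson_vertex m k) : A != B ->
  johnson m k (nonmultiples p k) A B = (p %| #|val A :&: val B|)%N.
Proof.
move=> AB; rewrite /johnson AB /=.
apply/forall_inP/idP => [h|pd l].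
  (* Distinct vertices meet in fewer than [k] points, so the intersection size is an ordinal that
     can be tested against [L]. *)
  apply: contraT => npd; have := h (Ordinal (card_johnson_setI AB)).
  by rewrite inE /= npd eqxx => /(_ isT).
by rewrite inE; apply: contra => /eqP <-.
Qed.

Section JohnsonBounds.
Context (R : realType) (p m : nat).
Hypotheses (p_prime : prime p) (m_large : ((p * p).*2 <= m)%N).
Let k := (p * p)%N.
Let G := johnson m k (nonmultiples p k).
Let n := #|johnson_vertex m k|.
Let Q : R := ((k.+2 * 2 ^ k)%:R * m%:R) ^+ p.
Let D := (m ^ p.-1).+1.

Let m_gt0 : (0 < m)%N.
Proof. by have := prime_gt0 p_prime; move: m_large; lia. Qed.

Let n_gt0 : (0 < n)%N.
Proof. by rewrite /n card_johnson_vertex bin_gt0; move: m_large; rewrite /k; lia. Qed.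

Let johnson_rank_rep : exists u w : johnson_vertex m k ->
  unit + {ffun 'I_p.-1 -> 'I_m} -> 'F_p, rank_rep G u w.
Proof.
apply: (rank_rep_mod_prime (f := val)) => // [A|A B AB].
  by rewrite (eqP (valP A)) dvdn_mulr.
by rewrite /G johnson_nonmultiples.
Qed.

Let card_rank_index : #|{: unit + {ffun 'I_p.-1 -> 'I_m}}| = D.
Proof. by rewrite card_sum card_unit card_ffun !card_ord. Qed.

Lemma johnson_alpha_le : (alpha G <= D)%N.
Proof.
have [u [w uw]] := johnson_rank_rep.
by rewrite -card_rank_index; exact: alpha_rank_rep uw.
Qed.

Lemma johnson_alpha_strong_pow_le j : (alpha (strong_pow G j) <= D ^ j)%N.
Proof.
have [u [w uw]] := johnson_rank_rep.
by rewrite -card_rank_index; exact: alpha_strong_pow_le uw.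
Qed.

(** One kernel serves twice: it vanishes on the edges of [G], which are the distinct nonadjacent
    pairs of the complement. It is thus a primal witness for [G] and a dual one for the
    complement. *)
Lemma johnson_theta_bounds : exists2 c : R, c <= Q &
  n%:R <= c * theta R G /\ theta R (compl_graph G) <= c.
Proof.
have cardv (A : johnson_vertex m k) : #|val A| = k := eqP (valP A).
(* The zeros [0, p, ..., (p - 1) * p] are exactly the multiples of [p] below [k], and the sizes
   [|A :&: B|] at adjacent pairs are among them. *)
have [||i ip|q [q0 qb qd]] :=
    @exists_vanishing_kernel R _ _ _ _ cardv (fun i => i * p)%N p.
- by rewrite card_ord.
- by move=> i j ij; rewrite ltn_pmul2r // prime_gt0.
- by rewrite ltn_pmul2r // prime_gt0.
have qdvd (A B : johnson_vertex m k) : A != B -> (p %| #|val A :&: val B|)%N ->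
    q #|val A :&: val B| = 0.
  move=> AB pd; rewrite -(divnK pd); apply: q0.
  by rewrite ltn_divLR ?prime_gt0 // card_johnson_setI.
have domq : dominates_ones (fun A B : johnson_vertex m k => q #|val A :&: val B|).
  exact: qd.
have diagq (A : johnson_vertex m k) : q #|val A :&: val A| = q k.
  by rewrite setIid cardv.
exists (q k).
  by apply: le_trans (ler_norm _) _; have := qb k (leqnn k); rewrite card_ord.
split.
  apply: (theta_lower (@johnson_irr _ _ _) n_gt0 domq) => // [A B|A B AB].
    by rewrite setIC.
  have AneB : A != B by case/andP: AB.
  by apply: qdvd => //; rewrite -johnson_nonmultiples.
apply: (theta_upper (@compl_graph_irr _ _) n_gt0 domq) => // A B AB.
by rewrite /compl_graph AB negbK /G johnson_nonmultiples //; exact: qdvd.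
Qed.

Lemma johnson_ratios :
  [/\ n%:R / (Q * D%:R) <= theta R G / (alpha G)%:R,
      n%:R / (Q * D%:R) <= theta R G / shannon_capacity R G
    & n%:R / (Q * D%:R) <= (chi G)%:R / theta R (compl_graph G)].
Proof.
have ratio (a b x y : R) : 0 < a -> 0 < y -> y <= b -> n%:R <= a * x ->
    n%:R / (a * b) <= x / y.
  move=> a0 y0 yb nx; have b0 := lt_le_trans y0 yb.
  rewrite ler_pdivlMr // mulrAC ler_pdivrMr ?mulr_gt0 // mulrA [x * a]mulrC.
  by apply: ler_pM => //; exact: ltW.
have [c cQ [lowG upG]] := johnson_theta_bounds.
have Girr : irreflexive G by exact: johnson_irr.
have theta1 := theta_ge1 R Girr n_gt0.
have theta1' := theta_ge1 R (@compl_graph_irr _ G) n_gt0.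
have c1 := le_trans theta1' upG.
have Q0 : 0 < Q by apply: lt_le_trans cQ; exact: lt_le_trans c1.
have nQ : n%:R <= Q * theta R G.
  by apply: le_trans lowG _; rewrite ler_wpM2r // (le_trans ler01).
split.
- apply: ratio => //; first by rewrite ltr0n alpha_gt0.
  by rewrite ler_nat johnson_alpha_le.
- apply: ratio => //.
    apply: lt_le_trans (shannon_capacity_ge1 R n_gt0 johnson_alpha_strong_pow_le).
    exact: ltr01.
  exact: (shannon_capacity_le R n_gt0 johnson_alpha_strong_pow_le).
(* Here [D] and [Q] exchange roles: [D] comes from [n <= chi G * alpha G], and [Q] bounds the
   denominator. *)
- rewrite [Q * _]mulrC; apply: ratio.
  + by rewrite ltr0n.
  + exact: lt_le_trans theta1'.
  + exact: le_trans cQ.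
  + rewrite -natrM ler_nat mulnC; apply: leq_trans (card_le_chi_alpha Girr) _.
    by rewrite leq_mul2l johnson_alpha_le orbT.
Qed.

End JohnsonBounds.

(** Raise the hypothesis on [m] to the power [2 / p], which is at most [eps], and use [n >= 1]. *)
Lemma root_growth (R : realType) (eps : R) (p m n K : nat) :
  (0 < p)%N -> (0 < n)%N -> 2 <= eps * p%:R -> (m ^ (p * p) <= K * n)%N ->
  m%:R ^+ (2 * p) <= K%:R `^ (2 / p%:R) * n%:R `^ eps.
Proof.
move=> p0 n0 ep mK; have pR : 0 < p%:R :> R by rewrite ltr0n.
have -> : m%:R ^+ (2 * p) = (m ^ (p * p))%:R `^ (2 / p%:R) :> R.
  rewrite natrX -!powR_mulrn // -powRrM; congr (_ `^ _).
  by rewrite !natrM; field; rewrite gt_eqF.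
apply: le_trans (_ : (K * n)%:R `^ (2 / p%:R) <= _).
  by apply: ge0_ler_powR; rewrite ?nnegrE ?ler_nat // divr_ge0.
rewrite natrM powRM //; apply: ler_wpM2l; first exact: powR_ge0.
by apply: ler_powR; rewrite ?ler1n // ler_pdivrMr.
Qed.

Theorem theorem5 (R : realType) (eps : R) : 0 < eps ->
  exists C : R, 0 < C /\
  forall N : nat, exists (m k : nat) (L : {set 'I_k}),
    let G := johnson m k L in
    let n : R := (#|johnson_vertex m k|)%:R in
    (N <= #|johnson_vertex m k|)%N /\
    C * n `^ (1 - eps) <= theta R G / (alpha G)%:R /\
    C * n `^ (1 - eps) <= theta R G / shannon_capacity R G /\
    C * n `^ (1 - eps) <= (chi G)%:R / theta R (compl_graph G).
Proof.
move=> eps0.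
(* [p] depends on [eps] alone, and so do [k], [K] and [c] below. *)
have [p p_large p_prime] := prime_above (Num.trunc (2 / eps)).
have p_gt0 := prime_gt0 p_prime.
have ep : 2 <= eps * p%:R.
  rewrite mulrC -ler_pdivrMr //; apply/ltW.
  by apply: lt_le_trans (truncnS_gt _) _; rewrite ler_nat.
pose k := (p * p)%N; pose K := (2 ^ k * k`!)%N.
have K0 : (0 < K)%N by rewrite muln_gt0 expn_gt0 fact_gt0.
(* The factor 2 comes from [m ^ (p - 1) + 1 <= 2 * m ^ p], the power of [(k + 2) * 2 ^ k] from the
   bound on [q k], and the last factor from [root_growth]. *)
pose c : R := 2 * (k.+2 * 2 ^ k)%:R ^+ p * K%:R `^ (2 / p%:R).
have c0 : 0 < c.
  by rewrite !mulr_gt0 ?exprn_gt0 ?powR_gt0 ?ltr0n // muln_gt0 expn_gt0.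
exists c^-1; split; first by rewrite invr_gt0.
(* The summand [K * N] forces at least [N] vertices, as [K * N <= m <= m ^ k <= K * 'C(m, k)]; the
   summand [k.*2] makes [expn_le_bin] applicable. *)
move=> N; pose m := (K * N + k.*2)%N.
have km : (k.*2 <= m)%N by rewrite leq_addl.
have k0 : (0 < k)%N by rewrite muln_gt0 p_gt0.
have m0 : (0 < m)%N by apply: leq_trans km; rewrite double_gt0.
have mn := expn_le_bin km.
exists m, k, (nonmultiples p k); move=> G n.
have n0 : (0 < #|johnson_vertex m k|)%N.
  by rewrite card_johnson_vertex bin_gt0; lia.
have [r1 r2 r3] := johnson_ratios R p_prime km.
rewrite -/k -/G -/n in r1 r2 r3.
split.
  rewrite card_johnson_vertex -(leq_pmul2l K0); apply: leq_trans mn.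
  apply: leq_trans (leq_addr k.*2 _) _; rewrite -/m -{1}[m]expn1.
  exact: leq_pexp2l.
suff low : c^-1 * n `^ (1 - eps) <=
    n / (((k.+2 * 2 ^ k)%:R * m%:R) ^+ p * (m ^ p.-1).+1%:R).
  by split; [|split]; apply: le_trans low _.
have nR0 : 0 < n by rewrite ltr0n.
have n1 : n `^ (1 - eps) * n `^ eps = n.
  by rewrite -powRD ?subrK ?powRr1 ?ltW // gt_eqF ?implybT.
rewrite ler_pdivlMr; last first.
  by rewrite mulr_gt0 ?exprn_gt0 ?mulr_gt0 ?ltr0n // muln_gt0 expn_gt0.
rewrite -mulrA ler_pdivrMl // -[in leRHS]n1 [leRHS]mulrCA.
apply: ler_wpM2l; first exact: powR_ge0.
have mD : (m ^ p.-1).+1%:R <= 2 * m%:R ^+ p :> R.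
  rewrite -natrX -natrM ler_nat mul2n -addnn -addn1; apply: leq_add.
    by apply: leq_pexp2l => //; exact: leq_pred.
  by rewrite expn_gt0 m0.
apply: le_trans (_ : _ <= ((k.+2 * 2 ^ k)%:R * m%:R) ^+ p * (2 * m%:R ^+ p)) _.
  by apply: ler_wpM2l mD; rewrite exprn_ge0 // mulr_ge0.
have := @root_growth R eps p m _ K p_gt0 n0 ep.
rewrite card_johnson_vertex => /(_ mn); rewrite -card_johnson_vertex -/n.
set a := (_ * _)%:R; move=> h.
rewrite exprMn mulrACA [a ^+ p * 2]mulrC -exprD addnn -mul2n /c -!mulrA.
by rewrite !ler_wpM2l // exprn_ge0.
Qed.
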